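(* Let $R$ be a commutative ring and let $S$ be the antipode of the Hopf algebra $\mathtt{NCQSym}$ over $R$. Besides the values $-S(\mathrm{F}_{\alpha}^{123})=\mathrm{F}_{\alpha^{t}}^{321}$ for all $\alpha\vDash3$, $-S(\mathrm{F}_{3}^{321})=\mathrm{F}_{111}^{123}$, and $-S(\mathrm{F}_{111}^{321})=\mathrm{F}_{3}^{123}$, the values of $-S(\mathrm{F}_{\alpha}^{\rho})$ for $\alpha\vDash3$ and $\rho\in S_{3}$ are as follows. For $\rho=321$: $-S(\mathrm{F}_{21}^{321})=\mathrm{F}_{12}^{123}-\mathrm{F}_{12}^{321}+\mathrm{F}_{21}^{321}$ and $-S(\mathrm{F}_{12}^{321})=\mathrm{F}_{21}^{123}-\mathrm{F}_{21}^{321}+\mathrm{F}_{12}^{321}$. For $\rho=132$: $-S(\mathrm{F}_{3}^{132})=\mathrm{F}_{111}^{231}+\mathrm{F}_{12}^{213}-\mathrm{F}_{12}^{312}$, $-S(\mathrm{F}_{21}^{132})=\mathrm{F}_{21}^{231}+\mathrm{F}_{12}^{213}-\mathrm{F}_{12}^{312}$, $-S(\mathrm{F}_{12}^{132})=\mathrm{F}_{12}^{231}+\mathrm{F}_{21}^{213}-\mathrm{F}_{21}^{312}$, $-S(\mathrm{F}_{111}^{132})=\mathrm{F}_{3}^{231}+\mathrm{F}_{21}^{213}-\mathrm{F}_{21}^{312}$. For $\rho=213$: $-S(\mathrm{F}_{3}^{213})=\mathrm{F}_{111}^{312}+\mathrm{F}_{21}^{132}-\mathrm{F}_{21}^{231}$,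 $-S(\mathrm{F}_{21}^{213})=\mathrm{F}_{21}^{312}+\mathrm{F}_{12}^{132}-\mathrm{F}_{12}^{231}$, $-S(\mathrm{F}_{12}^{213})=\mathrm{F}_{12}^{312}+\mathrm{F}_{21}^{132}-\mathrm{F}_{21}^{231}$, $-S(\mathrm{F}_{111}^{213})=\mathrm{F}_{3}^{312}+\mathrm{F}_{12}^{132}-\mathrm{F}_{12}^{231}$. For $\rho=231$: $-S(\mathrm{F}_{3}^{231})=\mathrm{F}_{12}^{213}-\mathrm{F}_{12}^{312}-\mathrm{F}_{3}^{132}+\mathrm{F}_{3}^{231}+\mathrm{F}_{111}^{231}$, $-S(\mathrm{F}_{21}^{231})=\mathrm{F}_{12}^{213}-\mathrm{F}_{12}^{312}-\mathrm{F}_{21}^{132}+2\mathrm{F}_{21}^{231}$, $-S(\mathrm{F}_{12}^{231})=\mathrm{F}_{21}^{213}-\mathrm{F}_{21}^{312}-\mathrm{F}_{12}^{132}+2\mathrm{F}_{12}^{231}$, $-S(\mathrm{F}_{111}^{231})=\mathrm{F}_{21}^{213}-\mathrm{F}_{21}^{312}-\mathrm{F}_{111}^{132}+\mathrm{F}_{111}^{231}+\mathrm{F}_{3}^{231}$. For $\rho=312$: $-S(\mathrm{F}_{3}^{312})=\mathrm{F}_{21}^{132}-\mathrm{F}_{21}^{231}-\mathrm{F}_{3}^{213}+\mathrm{F}_{3}^{312}+\mathrm{F}_{111}^{312}$, $-S(\mathrm{F}_{21}^{312})=\mathrm{F}_{12}^{132}-\mathrm{F}_{12}^{231}-\mathrm{F}_{21}^{213}+2\mathrm{F}_{21}^{312}$,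 $-S(\mathrm{F}_{12}^{312})=\mathrm{F}_{21}^{132}-\mathrm{F}_{21}^{231}-\mathrm{F}_{12}^{213}+2\mathrm{F}_{12}^{312}$, $-S(\mathrm{F}_{111}^{312})=\mathrm{F}_{12}^{132}-\mathrm{F}_{12}^{231}-\mathrm{F}_{111}^{213}+\mathrm{F}_{111}^{312}+\mathrm{F}_{3}^{312}$.
   Context: Notation: subscripts $3$, $21$, $12$, $111$ denote the compositions $(3)$, $(2,1)$, $(1,2)$, $(1,1,1)$ of $3$; superscripts are permutations in $S_{3}$ in one-line notation. A composition $\alpha\vDash n$ is a finite sequence $(\alpha_{1},\ldots,\alpha_{\ell})$ of positive integers summing to $n$, and $\beta\preceq\alpha$ means that $\beta$ refines $\alpha$, i.e., $\beta$ is the concatenation, in order, of compositions of $\alpha_{1},\ldots,\alpha_{\ell}$. For $\alpha\vDash3$ the transposes are $3^{t}=111$, $(21)^{t}=12^{\phantom{t}}\!\!$-type as follows: if $T=\{\alpha_{1}+\cdots+\alpha_{i}\;|\;1\leq i<\ell\}\subseteq\{1,2\}$ then $\alpha^{t}$ is the composition whose corresponding set of partial sums is $\{3-t\;|\;t\in\{1,2\}\setminus T\}$; thus $3^{t}=111$, $21^{t}=21$, $12^{t}=12$, $111^{t}=3$. The Hopf algebra $\mathtt{NCQSym}$ (word quasi-symmetric functions). Put $\mathbb{N}_{n}=\{1,\ldots,n\}$. A set composition $\mathbf{A}=(A_{1},\ldots,A_{\ell})\vDash\mathbb{N}_{n}$ is an ordered collection of non-empty pairwise disjoint sets with union $\mathbb{N}_{n}$.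 In the ring of power series over $R$ in non-commuting variables $x_{1},x_{2},\ldots$, for $\mathbf{A}\vDash\mathbb{N}_{n}$ of length $\ell$ and $I=\{i_{1}<\cdots<i_{\ell}\}\subseteq\mathbb{N}$, let $x_{I}^{\mathbf{A}}=x_{\eta_{1}}x_{\eta_{2}}\cdots x_{\eta_{n}}$, where $\eta_{k}=i_{j}$ if $k\in A_{j}$, and set $\mathrm{M}_{\mathbf{A}}=\sum_{|I|=\ell}x_{I}^{\mathbf{A}}$ (with $\mathrm{M}_{\emptyset}=1$). $\mathtt{NCQSym}$ is the free $R$-module with basis $\{\mathrm{M}_{\mathbf{A}}\}$, $\mathbf{A}$ running over set compositions of $\mathbb{N}_{n}$ for all $n\geq0$, graded by $n$; it is closed under the product of power series. Its co-multiplication is $\Delta(\mathrm{M}_{\mathbf{A}})=\sum_{k=0}^{\ell}\mathrm{M}_{\operatorname{st}(A_{1},\ldots,A_{k})}\otimes\mathrm{M}_{\operatorname{st}(A_{k+1},\ldots,A_{\ell})}$, where $\operatorname{st}$ transports a set composition of a finite $X\subseteq\mathbb{N}$ to one of $\mathbb{N}_{|X|}$ via the order-preserving bijection $X\to\mathbb{N}_{|X|}$; the co-unit is the projection onto degree $0$. This is a connected graded bi-algebra, hence a Hopf algebra, whose antipode is the two-sided convolution inverse of the identity. For $\alpha\vDash n$ and $\rho\in S_{n}$, $\mathbf{A}_{\alpha}^{\rho}\vDash\mathbb{N}_{n}$ is the set composition whose $j$th set is $\{\rho(k)\;|\;\alpha_{1}+\cdots+\alpha_{j-1}<k\leq\alpha_{1}+\cdots+\alpha_{j}\}$.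 Set $\mathrm{M}_{\alpha}^{\rho}=\mathrm{M}_{\mathbf{A}_{\alpha}^{\rho}}$ and $\mathrm{F}_{\alpha}^{\rho}=\sum_{\beta\preceq\alpha}\mathrm{M}_{\beta}^{\rho}$. *)

(* Defs.v *)
From HB Require Import structures.
From mathcomp Require Import all_boot all_order all_algebra.
From mathcomp Require Import finmap monalg.

Set Implicit Arguments.
Unset Strict Implicit.
Unset Printing Implicit Defensive.

Import GRing.Theory.
Local Open Scope fset_scope.

Definition is_composition (n : nat) (c : seq nat) : bool :=
  (0 \notin c) && (sumn c == n).

(* A composition of n.+2 starts either with 1, or with a part at least 2 *)
(* obtained by increasing the first part of a composition of n.+1. *)
Fixpoint compositions (n : nat) : seq (seq nat) :=
  match n with
  | 0 => [:: [::]]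
  | n'.+1 =>
      [seq 1 :: c | c <- compositions n'] ++
      (if n' is _.+1 then [seq (head 0 c).+1 :: behead c | c <- compositions n']
       else [::])
  end.

Fixpoint refinements (alpha : seq nat) : seq (seq nat) :=
  if alpha is a :: alpha' then
    [seq b ++ c | b <- compositions a, c <- refinements alpha']
  else [:: [::]].

(* The partial sums of alpha, other than 0 and n = sumn alpha. *)
Definition partial_sums (alpha : seq nat) : seq nat :=
  [seq sumn (take i alpha) | i <- iota 1 (size alpha).-1].

(* T' lists the numbers n - t with 1 <= t < n and t not a partial sum of *)
(* alpha, in increasing order; the parts of the transpose are the consecutive *)
(* differences of 0, T', n. *)
Definition transpose (alpha : seq nat) : seq nat :=
  let n := sumn alpha in
  let T' := [seq n - t | t <- rev (iota 1 n.-1) & t \notin partial_sums alpha] in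
  if n == 0 then [::] else pairmap (fun a b => b - a) 0 (rcons T' n).

Definition NN (n : nat) : {fset nat} := [fset k in iota 1 n].

Definition union (s : seq {fset nat}) : {fset nat} := \bigcup_(B <- s) B.

Definition is_setcomp_of (X : {fset nat}) (s : seq {fset nat}) : bool :=
  [&& fset0 \notin s, pairwise (fun B C => [disjoint B & C]) s & union s == X].

Definition is_setcomp (s : seq {fset nat}) : bool :=
  is_setcomp_of (NN #|` union s|) s.

Record setcomp := SetComp { blocks :> seq {fset nat}; _ : is_setcomp blocks }.
HB.instance Definition _ := [isSub for blocks].
HB.instance Definition _ := [Choice of setcomp by <:].

Definition degree (A : setcomp) : nat := #|` union A|.

Fact is_setcomp_nil : is_setcomp [::].
Proof.
rewrite /is_setcomp /is_setcomp_of /union big_nil cardfs0 /=.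
by apply/eqP/fsetP=> x; rewrite !inE.
Qed.

Definition setcomp0 : setcomp := SetComp is_setcomp_nil.

Definition rank (X : {fset nat}) (x : nat) : nat := #|` [fset y in X | y <= x]|.

Definition standardize (s : seq {fset nat}) : seq {fset nat} :=
  [seq [fset rank (union s) x | x in B] | B <- s].

(* The default value setcomp0 is never used on parts of a set composition: *)
(* see is_setcomp_standardize. *)
Definition st (s : seq {fset nat}) : setcomp := insubd setcomp0 (standardize s).

(* rho is a permutation in one-line notation; reshape cuts it into consecutive *)
(* blocks of sizes alpha_1, ..., alpha_l. *)
Definition Ablocks (alpha rho : seq nat) : seq {fset nat} :=
  [seq [fset x in b] | b <- reshape alpha rho].

(* The default value is never used when alpha is a composition of n and rho a *)
(* permutation of 1, ..., n: see is_setcomp_Ablocks. *)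
Definition Acomp (alpha rho : seq nat) : setcomp :=
  insubd setcomp0 (Ablocks alpha rho).

Lemma mem_union s x : reflect (exists2 B : {fset nat}, B \in s & x \in B) (x \in union s).
Proof.
rewrite /union; apply: (iffP (bigfcupP _ _ _ _)).
  by move=> [B /andP[Bs _] xB]; exists B.
by move=> [B Bs xB]; exists B => //; rewrite Bs.
Qed.

Lemma card_NN n : #|` NN n| = n.
Proof. by rewrite /NN card_fseq undup_id ?iota_uniq // size_iota. Qed.

Lemma in_NN n k : (k \in NN n) = (0 < k <= n).
Proof. by rewrite /NN inE mem_iota add1n ltnS. Qed.

Lemma is_setcomp_ofW n s : is_setcomp_of (NN n) s -> is_setcomp s.
Proof.
move=> H; have /and3P[_ _ /eqP E] := H.
by rewrite /is_setcomp E card_NN.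
Qed.

Lemma find_block s j k : is_setcomp s -> k \in nth fset0 s j ->
  find (fun B : {fset nat} => k \in B) s = j.
Proof.
move=> /and3P[_ dA _] kB.
have jA : j < size s by rewrite ltnNge; apply/negP=> ?; move: kB; rewrite nth_default ?inE.
apply/eqP; rewrite eqn_leq; apply/andP; split.
  by rewrite leqNgt; apply/negP=> /(before_find fset0); rewrite kB.
rewrite leqNgt; apply/negP=> lt_j.
have hasA : has (fun B : {fset nat} => k \in B) s.
  by rewrite has_find (ltn_trans lt_j jA).
have := nth_find fset0 hasA; set i' := find _ _ in lt_j * => ki'.
have /(pairwiseP fset0)/(_ i' j) := dA.
rewrite !inE (ltn_trans lt_j jA) jA => /(_ isT isT lt_j) /fdisjointP/(_ k ki').
by rewrite kB.
Qed.

Lemma rank_inj X : {in X &, injective (rank X)}.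
Proof.
suff lt_rank x y : y \in X -> x < y -> rank X x < rank X y.
  move=> x y xX yX E; case: (ltngtP x y) => // /lt_rank.
    by move=> /(_ yX); rewrite E ltnn.
  by move=> /(_ xX); rewrite E ltnn.
move=> yX xy; apply: fproper_ltn_card; rewrite fproperE; apply/andP; split.
  apply/fsubsetP.
  move=> z; rewrite !inE /= => /andP[-> zx] /=.
  exact: leq_trans zx (ltnW xy).
by apply/fsubsetPn; exists y; rewrite !inE /= yX //= -ltnNge.
Qed.

Lemma rank_image X : [fset rank X x | x in X] = NN #|` X|.
Proof.
apply/eqP; rewrite eqEfcard card_NN; apply/andP; split.
  apply/fsubsetP=> _ /imfsetP[x /= xX ->]; rewrite in_NN; apply/andP; split.
    by rewrite cardfs_gt0; apply/fset0Pn; exists x; rewrite !inE /= xX leqnn.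
  by apply: fsubset_leq_card; apply/fsubsetP=> y; rewrite !inE /= => /andP[].
by rewrite card_in_imfset //; exact: rank_inj.
Qed.

Lemma is_setcomp_standardize X s :
  is_setcomp_of X s -> is_setcomp_of (NN #|` X|) (standardize s).
Proof.
move=> /and3P[s0 ds /eqP<-]; apply/and3P; split.
- rewrite /standardize; apply/negP=> /(@mapP {fset nat})[B Bs /esym E].
  have [E'|[x xB]] := fset_0Vmem B; first by rewrite -E' Bs in s0.
  have : rank (union s) x \in [fset rank (union s) x | x in B].
    by apply/imfsetP; exists x.
  by rewrite E inE.
- rewrite /standardize pairwise_map.
  apply: (sub_in_pairwise (P := mem s)) ds => [B C Bs Cs /= /fdisjointP BC|]; last exact/allP.
  apply/fdisjointP=> _ /imfsetP[x /= xB ->]; apply/negP=> /imfsetP[y /= yC].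
  move/rank_inj=> E; have := BC x xB; rewrite E ?yC //; apply/mem_union.
    by exists B.
  by exists C.
- rewrite -rank_image; apply/eqP/fsetP=> z; apply/mem_union/imfsetP => /=.
    move=> [_ /(@mapP {fset nat})[B Bs ->] /imfsetP[x /= xB ->]]; exists x => //.
    by apply/mem_union; exists B.
  move=> [x /mem_union[B Bs xB] ->].
  exists [fset rank (union s) x0 | x0 in B]; first by apply: (@map_f {fset nat}).
  by apply/imfsetP; exists x.
Qed.

Lemma val_st X s : is_setcomp_of X s -> st s = standardize s :> seq _.
Proof.
move=> /is_setcomp_standardize /is_setcomp_ofW H.
by rewrite /st -[blocks _]/(val _) val_insubd H.
Qed.

Lemma is_setcomp_Ablocks n alpha rho :
  is_composition n alpha -> perm_eq rho (iota 1 n) ->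
  is_setcomp_of (NN n) (Ablocks alpha rho).
Proof.
move=> /andP[a0 /eqP sa] Hrho.
have usize : sumn alpha = size rho by rewrite (perm_size Hrho) size_iota.
have fl : flatten (reshape alpha rho) = rho.
  by apply: reshapeKr; rewrite usize.
have urho : uniq rho by rewrite (perm_uniq Hrho) iota_uniq.
have ushape : shape (reshape alpha rho) = alpha by apply: reshapeKl; rewrite usize.
rewrite /Ablocks; apply/and3P; split.
- apply/negP=> /mapP[b br /esym E]; move: a0; rewrite -ushape => /negP; apply.
  apply/mapP; exists b => //; case: b {br} E => // x b /fsetP/(_ x).
  by rewrite !inE eqxx.
- rewrite pairwise_map; have : uniq (flatten (reshape alpha rho)) by rewrite fl.
  move: (reshape alpha rho) => r {fl ushape}.
  elim: r => //= b r IH; rewrite cat_uniq => /and3P[_ /hasPn H /IH ->].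
  rewrite andbT; apply/allP=> c cr /=; apply/fdisjointP=> x; rewrite !inE => xb.
  apply/negP=> xc; have := H x; rewrite xb; case/(_ _)/negP => //.
  by apply/flattenP; exists c.
- apply/eqP/fsetP=> x.
  rewrite /NN !inE -(perm_mem Hrho) -[in RHS]fl; apply/mem_union/flattenP.
    by move=> [_ /mapP[b br ->]]; rewrite inE => xb; exists b.
  by move=> [b br xb]; exists [fset x in b]; [exact: map_f | rewrite inE].
Qed.

Lemma val_Acomp n alpha rho :
  is_composition n alpha -> perm_eq rho (iota 1 n) ->
  Acomp alpha rho = Ablocks alpha rho :> seq _.
Proof.
move=> Ha Hr; have /is_setcomp_ofW H := is_setcomp_Ablocks Ha Hr.
by rewrite /Acomp -[blocks _]/(val _) val_insubd H.
Qed.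

Lemma mem_compositions n c : (c \in compositions n) = is_composition n c.
Proof.
rewrite /is_composition; elim: n c => [|n IH] c.
  case: c => [|a c] //=; rewrite !inE /=.
  by case: a => [|a] //=; rewrite ?andbF.
rewrite /= mem_cat; apply/orP/idP.
  case.
    move=> /mapP[d]; rewrite IH => /andP[d0 /eqP sd] ->.
    by rewrite inE /= d0 sd add1n eqxx.
  case: n IH => // n IH /mapP[d]; rewrite IH => /andP[d0 /eqP sd] ->.
  by case: d d0 sd => //= a d; rewrite !inE !negb_or /= => /andP[_ ->] <-; rewrite addSn eqxx.
case: c => [|[|[|a]] c] //=; rewrite !inE /=.
  by rewrite add1n eqSS => H; left; apply: map_f; rewrite IH.
rewrite addSn eqSS => /andP[c0 sc]; right.
case: n IH sc => // n IH sc.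
by apply/mapP; exists (a.+1 :: c); rewrite //= IH inE /= c0.
Qed.

Lemma compositions_uniq n : uniq (compositions n).
Proof.
elim: n => // n IH /=; rewrite cat_uniq map_inj_uniq ?IH => [|x y [] //].
case: n IH => // n; move: (compositions n.+1) (@mem_compositions n.+1) => cs mem_cs IH /=.
apply/andP; split.
  apply/hasPn=> _ /mapP[d + ->]; rewrite mem_cs => /andP[d0 sd].
  apply/negP=> /mapP[e _ [E _]].
  by case: d d0 sd E => //= a d; rewrite inE negb_or => /andP[a0 _] _ E; rewrite E in a0.
rewrite map_inj_in_uniq // => x y; rewrite !mem_cs => /andP[_ sx] /andP[_ sy].
by case: x sx => // a x _; case: y sy => // b y _ /= [-> ->].
Qed.

Lemma refinementsP alpha beta :
  reflect (exists2 ss, beta = flatten ss &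
             all2 is_composition alpha ss)
          (beta \in refinements alpha).
Proof.
apply: (iffP idP).
  elim: alpha beta => [|a alpha IH] beta /=; first by rewrite inE => /eqP->; exists [::].
  move=> /allpairsP[[b c] /= [+ /IH[ss -> Hss] ->]]; rewrite mem_compositions => Hb.
  by exists (b :: ss) => //=; rewrite Hb.
move=> [ss ->]; elim: alpha ss => [|a alpha IH] [|b ss] //= /andP[Hb /IH Hss].
by apply: allpairs_f; rewrite // mem_compositions.
Qed.

Lemma refinements_uniq alpha : uniq (refinements alpha).
Proof.
elim: alpha => //= a alpha IH; apply: allpairs_uniq => //; first exact: compositions_uniq.
move=> _ _ /allpairsP[[b c] /= [+ _ ->]] /allpairsP[[b' c'] /= [+ _ ->]] /=.
rewrite !mem_compositions => /andP[b0 /eqP sb] /andP[b'0 /eqP sb'].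
suff E : b ++ c = b' ++ c' -> b = b' by move=> /[dup] /E-> /eqP; rewrite eqseq_cat // => /andP[_ /eqP->].
move: b0 b'0; have := sb; rewrite -{}sb' => {a sb IH}.
elim: b b' => [|x b IHb] [|y b'] //=; rewrite ?inE ?negb_or.
- by case: y.
- by case: x.
move=> sE /andP[_ b0] /andP[_ b'0] [xy E]; move: sE; rewrite xy => /addnI sE.
by rewrite (IHb b' sE b0 b'0 E).
Qed.

(* Words in the variables: the letter i stands for the variable x_{i+1}. *)

Definition monomial (I : {fset nat}) (A : setcomp) : seq nat :=
  [seq nth 0 (sort leq I) (find (fun B : {fset nat} => k \in B) A)
     | k <- iota 1 (degree A)].

(* The set I with x_I^A = w, if it exists, is the set of letters of w. *)
Definition has_monomial (A : setcomp) (w : seq nat) : bool :=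
  let I := [fset i in w] in (#|` I| == size A) && (monomial I A == w).

Lemma has_monomialP (A : setcomp) (w : seq nat) :
  reflect (exists2 I : {fset nat}, #|` I| = size A & monomial I A = w)
          (has_monomial A w).
Proof.
apply: (iffP andP) => [[/eqP ? /eqP ?]|[I cI mI]]; first by exists [fset i in w].
suff -> : [fset i in w] = I by split; apply/eqP.
have sI : size (sort leq I) = size A by rewrite size_sort.
apply/fsetP=> i; rewrite inE -mI; case: A cI sI mI => A HA /= cI sI mI.
have /and3P[A0 dA /eqP UA] := HA.
have memA k : (k \in iota 1 #|` union A|) = (k \in union A).
  by rewrite [in RHS]UA inE.
apply/mapP/idP.
  move=> [k]; rewrite /degree memA => /mem_union[B BA kB] ->.
  rewrite -(mem_sort leq); apply: mem_nth; rewrite sI -has_find.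
  by apply/hasP; exists B.
rewrite -(mem_sort leq) => iI.
have jA : (index i (sort leq I) < size A)%N by rewrite -sI index_mem.
set j := index _ _ in jA.
have [E|[k kB]] := fset_0Vmem (nth fset0 A j).
  by move: A0; rewrite -E mem_nth.
exists k; first by rewrite memA; apply/mem_union; exists (nth fset0 A j) => //; rewrite mem_nth.
suff -> : find (fun B : {fset nat} => k \in B) A = j by rewrite nth_index.
exact: find_block HA kB.
Qed.

Lemma has_monomial_ex (A : setcomp) : exists w, has_monomial A w.
Proof.
exists (monomial (NN (size A)) A); apply/has_monomialP.
by exists (NN (size A)); rewrite ?card_NN.
Qed.

Lemma has_monomial_inj (A B : setcomp) (w : seq nat) :
  has_monomial A w -> has_monomial B w -> A = B.
Proof.
move=> HA HB; apply: val_inj; rewrite /=.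
set I := [fset i in w].
suff E (C : setcomp) : has_monomial C w ->
    blocks C = [seq [fset k in iota 1 (size w) | nth 0 w k.-1 == i] | i <- sort leq I].
  by rewrite (E _ HA) (E _ HB).
rewrite /has_monomial -/I => {A B HA HB} /andP[/eqP cI /eqP mw].
have sI : size (sort leq I) = size C by rewrite size_sort.
have uI : uniq (sort leq I) by rewrite sort_uniq fset_uniq.
have sw : size w = degree C by rewrite -mw size_map size_iota.
apply: (@eq_from_nth _ fset0); first by rewrite size_map sI.
move=> j jC; rewrite (nth_map 0) ?sI //.
case: C cI mw sI sw jC => C HC /= cI mw sI sw jC.
have /and3P[C0 dC /eqP UC] := HC.
have memC k : (k \in iota 1 (size w)) = (k \in union C).
  by rewrite [in RHS]UC inE sw.
have nw k : k \in iota 1 (size w) ->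
    nth 0 w k.-1 = nth 0 (sort leq I) (find (fun B : {fset nat} => k \in B) C).
  rewrite mem_iota add1n ltnS => /andP[k0 kn].
  have kn' : k.-1 < size w by rewrite prednK.
  rewrite -[in LHS]mw (nth_map 0) ?size_iota -?sw // nth_iota // add1n prednK //.
apply/fsetP=> k; rewrite !inE /=.
apply/idP/andP.
  move=> kj.
  have kU : k \in iota 1 (size w).
    by rewrite memC; apply/mem_union; exists (nth fset0 C j) => //; rewrite mem_nth.
  by rewrite kU nw //; rewrite (find_block HC kj).
move=> [kU]; rewrite nw // nth_uniq ?sI //; last first.
  by rewrite -has_find; apply/hasP; move: kU; rewrite memC => /mem_union[B BC kB]; exists B.
move=> /eqP<-; apply: (@nth_find _ fset0 (fun B : {fset nat} => k \in B)).
by apply/hasP; move: kU; rewrite memC => /mem_union[B BC kB]; exists B.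
Qed.

(* Power series in non-commuting variables, as their coefficient functions on *)
(* words. *)

Local Open Scope ring_scope.

Definition series (R : comPzRingType) := seq nat -> R.

Definition one_series (R : comPzRingType) : series R := fun w => (w == [::])%:R.

Definition mul_series (R : comPzRingType) (f g : series R) : series R :=
  fun w => \sum_(i < (size w).+1) f (take i w) * g (drop i w).

Definition M_series (R : comPzRingType) (A : setcomp) : series R :=
  fun w => (has_monomial A w)%:R.

(* Free modules; the instance of the library on {malg R[K]} requires a *)
(* non-trivial ring R. *)

Definition freemod (R : comPzRingType) (K : choiceType) := {malg R[K]}.

Section FreeModule.
Variables (R : comPzRingType) (K : choiceType).

HB.instance Definition _ := GRing.Zmodule.on (freemod R K).

Definition fscale (c : R) (g : freemod R K) : freemod R K :=
  [malg k in msupp g => c * g@_k].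

Lemma fscaleE c g k : (fscale c g)@_k = c * g@_k.
Proof. by rewrite mcoeffE; case: msuppP => //; rewrite mulr0. Qed.

Fact fscaleA c d g : fscale c (fscale d g) = fscale (c * d) g.
Proof. by apply/malgP=> k; rewrite !fscaleE mulrA. Qed.

Fact fscale1 : left_id 1 fscale.
Proof. by move=> g; apply/malgP=> k; rewrite fscaleE mul1r. Qed.

Fact fscaleDr : right_distributive fscale +%R.
Proof. by move=> c g h; apply/malgP=> k; rewrite !(fscaleE, mcoeffD) mulrDr. Qed.

Fact fscaleDl g : {morph fscale^~ g : c d / c + d}.
Proof. by move=> c d; apply/malgP=> k; rewrite !(fscaleE, mcoeffD) mulrDl. Qed.

HB.instance Definition _ := GRing.Zmodule_isLmodule.Build R (freemod R K)
  fscaleA fscale1 fscaleDr fscaleDl.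

Definition basis (k : K) : freemod R K := << (1 : R) *g k >>.

Definition linext (V : lmodType R) (f : K -> V) (x : freemod R K) : V :=
  \sum_(k <- msupp x) x@_k *: f k.

End FreeModule.

Definition NCQSym (R : comPzRingType) := freemod R setcomp.

Section Hopf.
Variable R : comPzRingType.

(* NCQSym \otimes NCQSym, with basis M_A \otimes M_B. *)
Definition NCQSym2 := freemod R (setcomp * setcomp)%type.

Definition MA (A : setcomp) : NCQSym R := basis R A.

Definition to_series (x : NCQSym R) : series R :=
  fun w => \sum_(A <- msupp x) x@_A * M_series R A w.

Lemma to_series_inj : injective (fun x => to_series x : seq nat -> R).
Proof.
have E x A w : has_monomial A w -> to_series x w = x@_A.
  move=> Aw; rewrite /to_series.
  under eq_bigr => B _.
    have -> : M_series R B w = (B == A)%:R.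
      rewrite /M_series; congr (_%:R); congr nat_of_bool.
      by apply/idP/eqP => [/has_monomial_inj/(_ Aw)|->].
    over.
  case: (boolP (A \in msupp x)) => Ax.
    rewrite (big_fsetD1 A) //= eqxx mulr1 big1_seq ?addr0 // => B.
    by rewrite !inE => /andP[_ /andP[/negbTE-> _]]; rewrite mulr0.
  rewrite (mcoeff_outdom Ax) big1_seq // => B /andP[_ Bx].
  by case: eqP Bx => [->|_ _]; [rewrite (negbTE Ax) | rewrite mulr0].
move=> x y xy; apply/malgP=> A; have [w Aw] := has_monomial_ex A.
by rewrite -!(E _ _ _ Aw) xy.
Qed.

Definition comul_basis (A : setcomp) : NCQSym2 :=
  \sum_(k < (size A).+1) basis R (st (take k A), st (drop k A)).

Definition comul : NCQSym R -> NCQSym2 := linext comul_basis.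

Definition counit (x : NCQSym R) : R := x@_setcomp0.

(* The composite of comul, f \otimes g (for linear f and g), and the product of *)
(* NCQSym, which is that of power series: values are compared there, NCQSym *)
(* being a submodule by to_series_inj. *)
Definition convolution (f g : NCQSym R -> NCQSym R) (x : NCQSym R) : series R :=
  fun w => \sum_(p <- msupp (comul x))
    (comul x)@_p * mul_series (to_series (f (MA p.1))) (to_series (g (MA p.2))) w.

Definition is_antipode (S : {linear NCQSym R -> NCQSym R}) : Prop :=
  forall x w,
    convolution S id x w = counit x * one_series R w /\
    convolution id S x w = counit x * one_series R w.

Definition M (alpha rho : seq nat) : NCQSym R := MA (Acomp alpha rho).

Definition F (alpha rho : seq nat) : NCQSym R :=
  \sum_(beta <- refinements alpha) M beta rho.

End Hopf.

Arguments M {R} alpha rho.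
Arguments F {R} alpha rho.

(* Main.v *)
(* A set composition A of {1, ..., n} is encoded by the word of length n whose *)
(* k-th letter is the (0-based) index of the block containing k; then the      *)
(* coefficient of M_A on a word u is 1 if u has the same relative order as the *)
(* word of A, and 0 otherwise. The two halves of the coproduct of M_A are the  *)
(* subwords of small and of large letters, so S * id = counit expresses S(M_A) *)
(* by induction on the number of blocks, with integer coefficients not         *)
(* depending on R. Each identity is thus a computation on the 13 packed words  *)
(* of length 3.                                                                *)

Require Import Defs.
From mathcomp Require Import all_boot all_order all_algebra.
From mathcomp Require Import finmap monalg.

Import GRing.Theory.
Local Open Scope ring_scope.

(** Applied to a basis element with blocks A_1, ..., A_l, l > 0, the identity S * id = counit reads
    S(M_A) = - sum over k < l of S(M_st(A_1..A_k)) M_st(A_{k+1}..A_l), a triangular recursion on l.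
    It is run on coefficients of series rather than in the M basis: a product has as coefficient on
    u the sum over all cuts of u in two, M_A is the indicator of the words that pack to [word A]
    ([has_monomialE]), and the two factors of the coproduct are subwords ([word_take], [word_drop]).
    This gives integer coefficients for S(M_A) ([antipode_coefE]). Evaluation at [word A] recovers
    the coordinate at M_A ([to_series_word]), and everything is homogeneous, so an identity for S(F)
    in degree n amounts to equalities of integers, one for each packed word of length n
    ([antipode_F]). These are decided by computation and carried to R by the ring morphism from the
    integers. *)

(** * Set compositions as packed words *)

Definition pack (u : seq nat) : seq nat :=
  [seq index x (sort leq (undup u)) | x <- u].

Definition block_index (s : seq {fset nat}) (x : nat) : nat :=
  find (fun B : {fset nat} => x \in B) s.

Definition word (A : setcomp) : seq nat :=
  [seq block_index A k | k <- iota 1 (degree A)].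

Lemma is_setcomp_blocks (A : setcomp) : is_setcomp A.
Proof. by case: A. Qed.

Lemma mem_degree (A : setcomp) k : (k \in iota 1 (degree A)) = (k \in union A).
Proof.
by have /and3P[_ _ /eqP E] := is_setcomp_blocks A; rewrite [in RHS]E inE.
Qed.

Lemma has_union (s : seq {fset nat}) x :
  has (fun B : {fset nat} => x \in B) s = (x \in union s).
Proof.
by apply/hasP/mem_union => -[B Bs xB]; exists B.
Qed.

Lemma block_index_lt s x : (block_index s x < size s)%N = (x \in union s).
Proof. by rewrite /block_index -has_find has_union. Qed.

Lemma size_word A : size (word A) = degree A.
Proof. by rewrite size_map size_iota. Qed.

(** Blocks are non-empty, so every index below [size A] occurs; this is what makes [word A]
    packed. *)
Lemma mem_word A j : (j \in word A) = (j < size A)%N.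
Proof.
apply/mapP/idP => [[k + ->]|jA]; first by rewrite block_index_lt mem_degree.
have /and3P[A0 _ _] := is_setcomp_blocks A.
have [E|[k kB]] := fset_0Vmem (nth fset0 A j).
  by move: A0; rewrite -E mem_nth.
exists k; last by rewrite /block_index (find_block (is_setcomp_blocks A) kB).
by rewrite mem_degree; apply/mem_union; exists (nth fset0 A j); rewrite ?mem_nth.
Qed.

Lemma perm_undup_iota (s : seq nat) n :
  (forall j, (j \in s) = (j < n)%N) -> perm_eq (undup s) (iota 0 n).
Proof.
move=> s_n; apply: uniq_perm; rewrite ?undup_uniq ?iota_uniq // => j.
by rewrite mem_undup s_n mem_iota.
Qed.

Lemma size_undup_word A : size (undup (word A)) = size A.
Proof. by rewrite (perm_size (perm_undup_iota _ _ (mem_word A))) size_iota. Qed.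

Lemma pack_word A : pack (word A) = word A.
Proof.
rewrite /pack.
have -> : sort leq (undup (word A)) = iota 0 (size A).
  apply: (sorted_eq leq_trans anti_leq); rewrite ?iota_sorted //.
    exact: (sort_sorted leq_total).
  by rewrite perm_sort (perm_undup_iota _ _ (mem_word A)).
rewrite -[RHS]map_id; apply/eq_in_map => x; rewrite mem_word => xA /=.
by rewrite -{1}[x]add0n -(nth_iota 0 0 xA) index_uniq ?size_iota ?iota_uniq.
Qed.

Lemma mem_pack u j : (j \in pack u) = (j < size (undup u))%N.
Proof.
rewrite -(size_sort leq); apply/mapP/idP => [[x xu ->]|ju].
  by rewrite index_mem mem_sort mem_undup.
exists (nth 0%N (sort leq (undup u)) j).
  by rewrite -mem_undup -(mem_sort leq) mem_nth.
by rewrite index_uniq // sort_uniq undup_uniq.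
Qed.

Lemma size_undup_pack u : size (undup (pack u)) = size (undup u).
Proof. by rewrite (perm_size (perm_undup_iota _ _ (mem_pack u))) size_iota. Qed.

Lemma monomialE I A : monomial I A = [seq nth 0%N (sort leq I) j | j <- word A].
Proof. by rewrite /monomial /word -map_comp. Qed.

(** The word x_I^A lists the elements of I at the positions given by [word A]; packing replaces each
    letter by its position among the sorted distinct letters, which undoes this. *)
Lemma has_monomialE A u : has_monomial A u = (pack u == word A).
Proof.
rewrite /has_monomial monomialE card_fseq.
have -> : sort leq [fset i in u]%fset = sort leq (undup u).
  apply/(perm_sortP leq_total leq_trans anti_leq).
  by apply: uniq_perm; rewrite ?undup_uniq ?fset_uniq // => x; rewrite mem_undup inE.
apply/andP/eqP => [[/eqP su /eqP Eu]|Eu]; last first.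
  rewrite -Eu -size_undup_word -Eu size_undup_pack eqxx -map_comp; split => //.
  rewrite -[eqbRHS]map_id; apply/eqP/eq_in_map => x xu /=.
  by rewrite nth_index // mem_sort mem_undup.
rewrite /pack -[X in map _ X]Eu -map_comp -[RHS]map_id.
apply/eq_in_map => j; rewrite mem_word -su => jA /=.
by rewrite index_uniq ?sort_uniq ?undup_uniq // size_sort.
Qed.

Lemma word_inj : injective word.
Proof.
move=> A B AB; apply: (@has_monomial_inj A B (word A)).
  by rewrite has_monomialE pack_word.
by rewrite has_monomialE pack_word AB.
Qed.

(** * Standardization and deconcatenation on words *)

Lemma word_st X s : is_setcomp_of X s ->
  word (st s) = [seq block_index s x | x <- sort leq X].
Proof.
move=> Xs; have /and3P[_ _ /eqP UX] := Xs.
(* Ranks are monotone, injective on X and fill 1, ..., |X|, so reading X in increasing order is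
   reading the standardized ground set. *)
have rX : [seq rank X x | x <- sort leq X] = iota 1 #|` X|.
  have urX : uniq [seq rank X x | x <- sort leq X].
    rewrite map_inj_in_uniq ?sort_uniq ?fset_uniq // => x y.
    by rewrite !mem_sort; exact: rank_inj.
  apply: (sorted_eq leq_trans anti_leq); rewrite ?iota_sorted //.
    apply: (homo_sorted (e := leq)); last exact: (sort_sorted leq_total).
    move=> x y xy; apply: fsubset_leq_card; apply/fsubsetP => z.
    by rewrite !inE /= => /andP[-> zx] /=; exact: leq_trans zx xy.
  apply: uniq_perm; rewrite ?iota_uniq // => z.
  have := congr1 (fun Y : {fset nat} => z \in Y) (rank_image X).
  rewrite [in RHS]inE => <-.
  by apply/mapP/imfsetP => -[x /= xX ->]; exists x; rewrite ?mem_sort // in xX *.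
rewrite /word /degree (val_st Xs).
have /and3P[_ _ /eqP->] := is_setcomp_standardize Xs.
rewrite card_NN -rX -map_comp; apply/eq_in_map => x; rewrite mem_sort => xX /=.
rewrite /block_index /standardize find_map; apply: (@eq_in_find {fset nat}) => B Bs /=.
rewrite UX; apply/imfsetP/idP => [[y /= yB]|xB]; last by exists x.
have yX : y \in X by rewrite -UX; apply/mem_union; exists B.
by move/rank_inj => -> .
Qed.

Lemma is_setcomp_of_subseq s t X : is_setcomp_of X t -> subseq s t ->
  is_setcomp_of (union s) s.
Proof.
move=> /and3P[t0 dt _] st; apply/and3P; split => //.
  by apply: contra t0; exact: mem_subseq.
exact: subseq_pairwise st dt.
Qed.

(** Common core of [word_take] and [word_drop]: [p] selects the block indices that survive in [s]
    and [g] renumbers them, while standardization keeps the order of positions. *)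
Lemma word_st_sub (A : setcomp) s (p : pred nat) (g : nat -> nat) :
  subseq s A ->
  (forall x, x \in union A -> (x \in union s) = p (block_index A x)) ->
  (forall x, x \in union s -> block_index s x = g (block_index A x)) ->
  word (st s) = [seq g j | j <- word A & p j].
Proof.
move=> sA ps gs.
rewrite (word_st (union s)); last exact: is_setcomp_of_subseq (is_setcomp_blocks A) sA.
have -> : sort leq (union s) = [seq k <- iota 1 (degree A) | p (block_index A k)].
  apply: (sorted_eq leq_trans anti_leq).
  - exact: (sort_sorted leq_total).
  - by rewrite (sorted_filter leq_trans) // iota_sorted.
  apply: uniq_perm; rewrite ?sort_uniq ?fset_uniq ?filter_uniq ?iota_uniq // => x.
  rewrite mem_sort mem_filter mem_degree.
  apply/idP/andP => [xs|[px xA]]; last by rewrite ps.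
  have xA : x \in union A.
    by have /mem_union[B Bs xB] := xs; apply/mem_union; exists B; rewrite // (mem_subseq sA).
  by rewrite -ps.
rewrite filter_map -map_comp; apply/eq_in_map => x; rewrite mem_filter mem_degree.
by case/andP => px xA /=; rewrite gs // ps.
Qed.

Lemma word_take (A : setcomp) k :
  word (st (take k A)) = [seq j <- word A | (j < k)%N].
Proof.
rewrite -[RHS]map_id; apply: (word_st_sub _ _ (fun j => j < k)%N id).
- exact: take_subseq.
- by move=> x xA; rewrite -has_union has_take ?has_union.
- move=> x; rewrite -has_union => xs.
  by rewrite /block_index -[in RHS](cat_take_drop k A) find_cat xs.
Qed.

Lemma word_drop (A : setcomp) k :
  word (st (drop k A)) = [seq (j - k)%N | j <- word A & (k <= j)%N].
Proof.
have ind x : x \in union (drop k A) -> block_index A x = (k + block_index (drop k A) x)%N.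
  move=> xs; apply: (find_block (is_setcomp_blocks A)).
  rewrite -nth_drop; apply: (nth_find fset0 (a := fun B : {fset nat} => x \in B)).
  by rewrite has_union.
apply: (word_st_sub _ _ (fun j => k <= j)%N (fun j => j - k)%N).
- exact: drop_subseq.
- move=> x xA; apply/idP/idP => [/ind->|kx]; first exact: leq_addr.
  have xA' : has (fun B : {fset nat} => x \in B) A by rewrite has_union.
  rewrite -has_union; apply/(has_nthP fset0); exists (block_index A x - k)%N.
    by rewrite size_drop ltn_sub2r // ?block_index_lt // (leq_ltn_trans kx) ?block_index_lt.
  by rewrite nth_drop subnKC //; exact: (nth_find fset0 xA').
- by move=> x /ind ->; rewrite addKn.
Qed.

Definition comp_word (alpha rho : seq nat) : seq nat :=
  [seq find (fun b : seq nat => k \in b) (reshape alpha rho) | k <- iota 1 (size rho)].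

Lemma word_Acomp n alpha rho :
  is_composition n alpha -> perm_eq rho (iota 1 n) ->
  word (Acomp alpha rho) = comp_word alpha rho.
Proof.
move=> Ha Hr; rewrite /word /degree (val_Acomp Ha Hr).
have /and3P[_ _ /eqP->] := is_setcomp_Ablocks Ha Hr.
rewrite card_NN /comp_word (perm_size Hr) size_iota; apply: eq_map => k.
by rewrite /block_index /Ablocks find_map; apply: eq_find => b /=; rewrite inE.
Qed.

(** * Linear extension and coordinates *)

Lemma sum_msuppS (R : comPzRingType) (K : choiceType) (V : lmodType R)
    (x : freemod R K) (D : {fset K}) (f : K -> V) :
  (msupp x `<=` D)%fset -> linext f x = \sum_(k <- D) x@_k *: f k.
Proof.
move=> xD; rewrite /linext; apply: big_fset_incl => // k _ kx.
by rewrite (mcoeff_outdom kx) scale0r.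
Qed.

Lemma linextD (R : comPzRingType) (K : choiceType) (V : lmodType R) (f : K -> V)
    (x y : freemod R K) : linext f (x + y) = linext f x + linext f y.
Proof.
set D := (msupp x `|` msupp y)%fset.
rewrite !(sum_msuppS _ _ _ _ D) ?fsubsetUl ?fsubsetUr ?msuppD_le //.
by rewrite -big_split; apply: eq_bigr => k _; rewrite mcoeffD scalerDl.
Qed.

Lemma linext_basis (R : comPzRingType) (K : choiceType) (V : lmodType R) (f : K -> V) k :
  linext f (basis R k) = f k.
Proof.
rewrite (sum_msuppS _ _ _ _ [fset k]%fset) ?msuppU_le // big_seq_fset1.
by rewrite mcoeffUU scale1r.
Qed.

Lemma linext_sum_basis (R : comPzRingType) (K : choiceType) (V : lmodType R) (f : K -> V)
    (I : Type) (r : seq I) (g : I -> K) :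
  linext f (\sum_(i <- r) basis R (g i)) = \sum_(i <- r) f (g i).
Proof.
elim: r => [|i r IH]; rewrite ?big_nil ?big_cons ?linextD ?linext_basis ?IH //.
by rewrite /linext msupp0 big_seq_fset0.
Qed.

Lemma M_seriesE (R : comPzRingType) A u : M_series R A u = (pack u == word A)%:R.
Proof. by rewrite /M_series has_monomialE. Qed.

Lemma to_series_MA (R : comPzRingType) A u : to_series (MA R A) u = M_series R A u.
Proof. exact: (@linext_basis R setcomp R^o (fun B => M_series R B u)). Qed.

(** The words [word A] are dual to the basis: M_B has coefficient 1 on [word A] if B = A, and 0
    otherwise. *)
Lemma to_series_word (R : comPzRingType) (x : NCQSym R) A : to_series x (word A) = x@_A.
Proof.
have E B : M_series R B (word A) = (B == A)%:R.
  by rewrite M_seriesE pack_word (inj_eq word_inj) eq_sym.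
rewrite /to_series; under eq_bigr do rewrite E.
have [Ax|Ax] := boolP (A \in msupp x); last first.
  rewrite (mcoeff_outdom Ax) big1_seq // => B /andP[_ Bx].
  by case: eqP Bx => [->|_ _]; rewrite ?(negbTE Ax) ?mulr0.
rewrite (big_fsetD1 A) //= eqxx mulr1 big1_seq ?addr0 // => B.
by rewrite !inE => /andP[_ /andP[/negbTE-> _]]; rewrite mulr0.
Qed.

(* Iterated sums over sequences, unlike bigops, reduce under vm_compute. *)
Definition sumz (T : Type) (f : T -> int) (s : seq T) : int :=
  foldr (fun x => +%R (f x)) 0 s.

Lemma sumzE (T : Type) (f : T -> int) s : sumz T f s = \sum_(x <- s) f x.
Proof. by elim: s => [|x s IH]; rewrite ?big_nil ?big_cons //= IH. Qed.

Lemma sum_iota (V : nmodType) (f : nat -> V) n :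
  \sum_(i <- iota 0 n) f i = \sum_(i < n) f i.
Proof. by rewrite -(big_mkord xpredT) /index_iota subn0. Qed.

(* The coefficient of S(M_A) on u, where w is the word of A, provided that A  *)
(* has less than n blocks: n is the recursion fuel.                           *)
Fixpoint antipode_coef (n : nat) (w u : seq nat) : int :=
  if n is n'.+1 then
    ((w == [::]) && (u == [::]))%:Z -
    sumz nat (fun k => sumz nat (fun i =>
        antipode_coef n' [seq j <- w | (j < k)%N] (take i u) *
        (pack (drop i u) == [seq (j - k)%N | j <- w & (k <= j)%N])%:Z)
      (iota 0 (size u).+1)) (iota 0 (size (undup w)))
  else 0.

Lemma antipode_coefS n w u : antipode_coef n.+1 w u =
  ((w == [::]) && (u == [::]))%:Z -
  \sum_(k < size (undup w)) \sum_(i < (size u).+1)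
    antipode_coef n [seq j <- w | (j < k)%N] (take i u) *
    (pack (drop i u) == [seq (j - k)%N | j <- w & (k <= j)%N])%:Z.
Proof.
rewrite [LHS]/antipode_coef -/antipode_coef sumzE sum_iota; congr (_ - _).
by apply: eq_bigr => k _; rewrite sumzE sum_iota.
Qed.

(** * The antipode on the M basis *)

Section Antipode.
Variables (R : comPzRingType) (S : {linear NCQSym R -> NCQSym R}).
Hypothesis antipodeS : is_antipode S.

Lemma counit_MA A : counit (MA R A) = (word A == [::])%:R.
Proof.
rewrite /counit mcoeffU -mulr_natr mul1r; congr (_%:R); congr nat_of_bool.
have w0 : word setcomp0 = [::].
  by apply/eqP; rewrite -size_eq0 size_word /degree /union /= big_nil cardfs0.
by rewrite -w0 (inj_eq word_inj).
Qed.

Lemma antipode_sum (A : setcomp) u :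
  \sum_(k < (size A).+1)
     mul_series (to_series (S (MA R (st (take k A))))) (M_series R (st (drop k A))) u
  = ((word A == [::]) && (u == [::]))%:R.
Proof.
have [+ _] := antipodeS (MA R A) u; rewrite counit_MA /one_series.
rewrite -natrM mulnb => <-; rewrite /convolution /comul linext_basis /comul_basis.
(* The convolution sums over the support of the coproduct; being the linear extension of [h], it can
   be evaluated term by term on the deconcatenation sum. *)
set h := fun p : setcomp * setcomp =>
  mul_series (to_series (S (MA R p.1))) (to_series (MA R p.2)) u.
rewrite [RHS](@linext_sum_basis R _ R^o h); apply: eq_bigr => k _.
by apply: eq_bigr => i _; rewrite to_series_MA.
Qed.

Lemma antipode_coefE n (A : setcomp) u : (size A < n)%N ->
  to_series (S (MA R A)) u = (antipode_coef n (word A) u)%:~R.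
Proof.
elim: n A u => // n IH A u An.
(* The counit term becomes the full deconcatenation sum, whose last term, k = [size A], is S(M_A)
   times 1; the earlier terms cancel against the recursion. *)
rewrite antipode_coefS intrB -pmulrn -antipode_sum big_ord_recr /=.
have -> : st (take (size A) A) = A.
  apply: word_inj; rewrite word_take; apply/all_filterP/allP => j.
  by rewrite mem_word.
have dropA : word (st (drop (size A) A)) = [::].
  rewrite word_drop; apply/eqP; rewrite -size_eq0 size_map size_filter.
  by rewrite eqn0Ngt -has_count; apply/hasPn => j; rewrite mem_word -ltnNge.
have -> : mul_series (to_series (S (MA R A))) (M_series R (st (drop (size A) A))) u
    = to_series (S (MA R A)) u.
  (* The right factor is the unit series, so only the cut leaving an empty suffix contributes. *)
  rewrite /mul_series big_ord_recr /= big1 => [|i _].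
    by rewrite M_seriesE dropA take_size drop_size mulr1 add0r.
  rewrite M_seriesE dropA -size_eq0 size_map size_drop subn_eq0 leqNgt ltn_ord.
  by rewrite mulr0.
suff -> : (\sum_(k < size (undup (word A))) \sum_(i < (size u).+1)
      antipode_coef n [seq j <- word A | (j < k)%N] (take i u) *
      (pack (drop i u) == [seq (j - k)%N | j <- word A & (k <= j)%N])%:Z)%:~R =
    \sum_(k < size A)
      mul_series (to_series (S (MA R (st (take k A))))) (M_series R (st (drop k A))) u.
  by rewrite addrAC subrr add0r.
rewrite size_undup_word rmorph_sum.
apply: eq_bigr => k _; rewrite rmorph_sum.
apply: eq_bigr => i _; rewrite /= intrM -pmulrn M_seriesE word_drop -word_take -IH //.
rewrite (val_st (is_setcomp_of_subseq _ _ _ (is_setcomp_blocks A) (take_subseq _ _))).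
by rewrite size_map size_take ltn_ord (leq_trans (ltn_ord k)).
Qed.

(** Homogeneity of S: a non-zero product in the recursion matches the small letters of w with a
    prefix of u and the large ones with the suffix, in equal lengths. *)
Lemma size_antipode_coef n w u : size w != size u -> antipode_coef n w u = 0.
Proof.
elim: n w u => // n IH w u wu; rewrite antipode_coefS big1 => [|k _].
  by case: w u wu => [|a w] [|b u].
rewrite big1 // => i _.
have [si|/IH->] := eqVneq (size [seq j <- w | (j < k)%N]) (size (take i u)); last exact: mul0r.
case: eqP => [E|_]; last exact: mulr0.
case/eqP: wu; rewrite -(count_predC (fun j => j < k)%N w) -size_filter si.
rewrite -[in RHS](cat_take_drop i u) size_cat; congr (_ + _)%N.
have := congr1 size E; rewrite !size_map size_filter => ->.
by apply: eq_count => j; rewrite /= -leqNgt.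
Qed.

(** * Coefficients of F and S(F), and the finite check *)

Definition F_coef alpha rho u : int :=
  sumz _ (fun beta => (u == comp_word beta rho)%:Z) (refinements alpha).

Definition antipode_F_coef n alpha rho u : int :=
  sumz _ (fun beta => antipode_coef n.+1 (comp_word beta rho) u) (refinements alpha).

(** Computable guarantee that [Acomp] never takes its default value in the expansion of F. *)
Definition valid_index n (alpha rho : seq nat) : bool :=
  perm_eq rho (iota 1 n) && all (is_composition n) (refinements alpha).

Lemma size_comp_word alpha rho : size (comp_word alpha rho) = size rho.
Proof. by rewrite size_map size_iota. Qed.

Lemma valid_word n alpha rho beta : valid_index n alpha rho ->
  beta \in refinements alpha -> word (Acomp beta rho) = comp_word beta rho.
Proof. by move=> /andP[Hr /allP Ha] /Ha/word_Acomp; apply. Qed.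

Lemma mcoeff_F n alpha rho A : valid_index n alpha rho ->
  (F alpha rho : NCQSym R)@_A = (F_coef alpha rho (word A))%:~R.
Proof.
move=> v; rewrite /F_coef sumzE rmorph_sum /F raddf_sum /=.
apply: eq_big_seq => beta /(valid_word _ _ _ _ v) wb.
by rewrite /M /MA /basis mcoeffU -mulr_natr mul1r -wb (inj_eq word_inj) eq_sym.
Qed.

Lemma mcoeff_antipode_F n alpha rho A : valid_index n alpha rho ->
  (S (F alpha rho))@_A = (antipode_F_coef n alpha rho (word A))%:~R.
Proof.
move=> v; rewrite /antipode_F_coef sumzE rmorph_sum /F !raddf_sum /=.
apply: eq_big_seq => beta /(valid_word _ _ _ _ v) wb.
rewrite /M -to_series_word (antipode_coefE n.+1) ?wb //.
(* The number of blocks is the number of distinct letters of a word of length n, hence at most n: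
   fuel [n.+1] suffices. *)
have /andP[/perm_size Hr _] := v.
rewrite -size_undup_word wb ltnS (leq_trans (size_undup _)) //.
by rewrite size_comp_word Hr size_iota.
Qed.

Fixpoint words (m n : nat) : seq (seq nat) :=
  if n is n'.+1 then [seq a :: v | a <- iota 0 m, v <- words m n'] else [:: [::]].

Lemma mem_words m u : all (fun a => a < m)%N u -> u \in words m (size u).
Proof.
elim: u => //= a u IH /andP[am /IH um].
by apply: allpairs_f; rewrite // mem_iota.
Qed.

(* c lists triples (beta, sigma, k) standing for k F_beta^sigma. *)
Definition check_antipode_F n alpha rho (c : seq (seq nat * seq nat * int)) : bool :=
  [&& valid_index n alpha rho, all (fun t => valid_index n t.1.1 t.1.2) c &
    all (fun u => (pack u == u) ==>
      (- antipode_F_coef n alpha rho u == sumz _ (fun t => F_coef t.1.1 t.1.2 u * t.2) c))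
    (words n n)].

(** Coordinates are compared at each A: if A has degree n, [word A] is among the packed words
    tested; otherwise both sides vanish by homogeneity. *)
Lemma antipode_F n alpha rho c : check_antipode_F n alpha rho c ->
  - S (F alpha rho) = \sum_(t <- c) F t.1.1 t.1.2 *~ t.2.
Proof.
case/and3P => v /allP vc /allP chk; apply/malgP => A.
rewrite mcoeffN (mcoeff_antipode_F n) // raddf_sum /=.
under eq_big_seq => t tc do rewrite raddfMz /= (mcoeff_F n) ?vc // -mulrzr -intrM.
rewrite -(rmorph_sum (intr : {rmorphism int -> R})) -sumzE -intrN; congr (_%:~R).
have [An|An] := eqVneq (degree A) n.
  (* The letters are below the number of distinct letters, which is at most the length n. *)
  have /chk : word A \in words n n.
    rewrite -{2}An -size_word; apply: mem_words; apply/allP => j.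
    by rewrite mem_word -size_undup_word => /leq_trans->; rewrite // -An -size_word size_undup.
  by rewrite pack_word eqxx => /eqP.
have F0 beta rho' : valid_index n beta rho' -> F_coef beta rho' (word A) = 0.
  case/andP => /perm_size Hr _; rewrite /F_coef sumzE big1 // => b _.
  case: eqP => // /(congr1 size); rewrite size_comp_word size_word Hr size_iota => E.
  by rewrite E eqxx in An.
rewrite sumzE big1_seq => [|t /andP[_ /vc tv]]; last by rewrite F0 ?mul0r.
rewrite /antipode_F_coef sumzE big1 ?oppr0 // => b _; apply: size_antipode_coef.
have /andP[/perm_size Hr _] := v.
by rewrite size_comp_word size_word Hr size_iota eq_sym.
Qed.
End Antipode.

(** * The values in degree 3 *)

(** Brings a sum over a list to the shape of a written sum: left-associated, starting at the first
    term, with no final 0. *)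
Lemma sum_cons_foldl (V : zmodType) (T : Type) (f : T -> V) t c :
  \sum_(x <- t :: c) f x = foldl (fun v x => v + f x) (f t) c.
Proof.
rewrite big_cons; elim: c (f t) => [|x c IH] v; first by rewrite big_nil addr0.
by rewrite big_cons addrA IH.
Qed.

(* A left-associated sum of terms *~ 1, *~ -1 and *~ 2 is convertible to the *)
(* expression with + F, - F and F *+ 2. *)
Tactic Notation "antipode_value" constr(antipodeS) uconstr(c) :=
  rewrite (antipode_F _ _ antipodeS 3 _ _ c);
  [ rewrite sum_cons_foldl; reflexivity | by vm_compute ].

Theorem proposition5p39 (R : comPzRingType)
    (S : {linear NCQSym R -> NCQSym R}) (antipodeS : is_antipode S) :
  (forall alpha : seq nat, is_composition 3 alpha ->
     - S (F alpha [:: 1; 2; 3]%N) = F (transpose alpha) [:: 3; 2; 1]%N)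
  /\ (- S (F [:: 3]%N [:: 3; 2; 1]%N)
        = F [:: 1; 1; 1]%N [:: 1; 2; 3]%N /\
       - S (F [:: 1; 1; 1]%N [:: 3; 2; 1]%N)
        = F [:: 3]%N [:: 1; 2; 3]%N)
  /\ (- S (F [:: 2; 1]%N [:: 3; 2; 1]%N)
        = F [:: 1; 2]%N [:: 1; 2; 3]%N - F [:: 1; 2]%N [:: 3; 2; 1]%N
          + F [:: 2; 1]%N [:: 3; 2; 1]%N /\
       - S (F [:: 1; 2]%N [:: 3; 2; 1]%N)
        = F [:: 2; 1]%N [:: 1; 2; 3]%N - F [:: 2; 1]%N [:: 3; 2; 1]%N
          + F [:: 1; 2]%N [:: 3; 2; 1]%N)
  /\ (- S (F [:: 3]%N [:: 1; 3; 2]%N)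
        = F [:: 1; 1; 1]%N [:: 2; 3; 1]%N + F [:: 1; 2]%N [:: 2; 1; 3]%N
          - F [:: 1; 2]%N [:: 3; 1; 2]%N /\
       - S (F [:: 2; 1]%N [:: 1; 3; 2]%N)
        = F [:: 2; 1]%N [:: 2; 3; 1]%N + F [:: 1; 2]%N [:: 2; 1; 3]%N
          - F [:: 1; 2]%N [:: 3; 1; 2]%N /\
       - S (F [:: 1; 2]%N [:: 1; 3; 2]%N)
        = F [:: 1; 2]%N [:: 2; 3; 1]%N + F [:: 2; 1]%N [:: 2; 1; 3]%N
          - F [:: 2; 1]%N [:: 3; 1; 2]%N /\
       - S (F [:: 1; 1; 1]%N [:: 1; 3; 2]%N)
        = F [:: 3]%N [:: 2; 3; 1]%N + F [:: 2; 1]%N [:: 2; 1; 3]%N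
          - F [:: 2; 1]%N [:: 3; 1; 2]%N)
  /\ (- S (F [:: 3]%N [:: 2; 1; 3]%N)
        = F [:: 1; 1; 1]%N [:: 3; 1; 2]%N + F [:: 2; 1]%N [:: 1; 3; 2]%N
          - F [:: 2; 1]%N [:: 2; 3; 1]%N /\
       - S (F [:: 2; 1]%N [:: 2; 1; 3]%N)
        = F [:: 2; 1]%N [:: 3; 1; 2]%N + F [:: 1; 2]%N [:: 1; 3; 2]%N
          - F [:: 1; 2]%N [:: 2; 3; 1]%N /\
       - S (F [:: 1; 2]%N [:: 2; 1; 3]%N)
        = F [:: 1; 2]%N [:: 3; 1; 2]%N + F [:: 2; 1]%N [:: 1; 3; 2]%N
          - F [:: 2; 1]%N [:: 2; 3; 1]%N /\
       - S (F [:: 1; 1; 1]%N [:: 2; 1; 3]%N)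
        = F [:: 3]%N [:: 3; 1; 2]%N + F [:: 1; 2]%N [:: 1; 3; 2]%N
          - F [:: 1; 2]%N [:: 2; 3; 1]%N)
  /\ (- S (F [:: 3]%N [:: 2; 3; 1]%N)
        = F [:: 1; 2]%N [:: 2; 1; 3]%N - F [:: 1; 2]%N [:: 3; 1; 2]%N
          - F [:: 3]%N [:: 1; 3; 2]%N + F [:: 3]%N [:: 2; 3; 1]%N
          + F [:: 1; 1; 1]%N [:: 2; 3; 1]%N /\
       - S (F [:: 2; 1]%N [:: 2; 3; 1]%N)
        = F [:: 1; 2]%N [:: 2; 1; 3]%N - F [:: 1; 2]%N [:: 3; 1; 2]%N
          - F [:: 2; 1]%N [:: 1; 3; 2]%N + F [:: 2; 1]%N [:: 2; 3; 1]%N *+ 2 /\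
       - S (F [:: 1; 2]%N [:: 2; 3; 1]%N)
        = F [:: 2; 1]%N [:: 2; 1; 3]%N - F [:: 2; 1]%N [:: 3; 1; 2]%N
          - F [:: 1; 2]%N [:: 1; 3; 2]%N + F [:: 1; 2]%N [:: 2; 3; 1]%N *+ 2 /\
       - S (F [:: 1; 1; 1]%N [:: 2; 3; 1]%N)
        = F [:: 2; 1]%N [:: 2; 1; 3]%N - F [:: 2; 1]%N [:: 3; 1; 2]%N
          - F [:: 1; 1; 1]%N [:: 1; 3; 2]%N + F [:: 1; 1; 1]%N [:: 2; 3; 1]%N
          + F [:: 3]%N [:: 2; 3; 1]%N)
  /\ (- S (F [:: 3]%N [:: 3; 1; 2]%N)
        = F [:: 2; 1]%N [:: 1; 3; 2]%N - F [:: 2; 1]%N [:: 2; 3; 1]%N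
          - F [:: 3]%N [:: 2; 1; 3]%N + F [:: 3]%N [:: 3; 1; 2]%N
          + F [:: 1; 1; 1]%N [:: 3; 1; 2]%N /\
       - S (F [:: 2; 1]%N [:: 3; 1; 2]%N)
        = F [:: 1; 2]%N [:: 1; 3; 2]%N - F [:: 1; 2]%N [:: 2; 3; 1]%N
          - F [:: 2; 1]%N [:: 2; 1; 3]%N + F [:: 2; 1]%N [:: 3; 1; 2]%N *+ 2 /\
       - S (F [:: 1; 2]%N [:: 3; 1; 2]%N)
        = F [:: 2; 1]%N [:: 1; 3; 2]%N - F [:: 2; 1]%N [:: 2; 3; 1]%N
          - F [:: 1; 2]%N [:: 2; 1; 3]%N + F [:: 1; 2]%N [:: 3; 1; 2]%N *+ 2 /\
       - S (F [:: 1; 1; 1]%N [:: 3; 1; 2]%N)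
        = F [:: 1; 2]%N [:: 1; 3; 2]%N - F [:: 1; 2]%N [:: 2; 3; 1]%N
          - F [:: 1; 1; 1]%N [:: 2; 1; 3]%N + F [:: 1; 1; 1]%N [:: 3; 1; 2]%N
          + F [:: 3]%N [:: 3; 1; 2]%N).
Proof.
split=> [alpha|].
  rewrite -mem_compositions => alpha3.
  (* [compositions 3] is a complete list by [mem_compositions], so the quantifier over alpha reduces
     to four checks. *)
  have checks : all (fun alpha => check_antipode_F 3 alpha [:: 1; 2; 3]%N
      [:: (transpose alpha, [:: 3; 2; 1]%N, 1%Z)]) (compositions 3) by vm_compute.
  by rewrite (antipode_F _ _ antipodeS _ _ _ _ (allP checks _ alpha3)) big_seq1 mulr1z.
(* Each list below transcribes the right-hand side of one identity, in the same order of terms,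
   since the two are matched by conversion. *)
repeat match goal with |- _ /\ _ => split end.
- antipode_value antipodeS [:: ([:: 1; 1; 1]%N, [:: 1; 2; 3]%N, 1)].
- antipode_value antipodeS [:: ([:: 3]%N, [:: 1; 2; 3]%N, 1)].
- antipode_value antipodeS
    [:: ([:: 1; 2]%N, [:: 1; 2; 3]%N, 1); ([:: 1; 2]%N, [:: 3; 2; 1]%N, -1);
        ([:: 2; 1]%N, [:: 3; 2; 1]%N, 1)].
- antipode_value antipodeS
    [:: ([:: 2; 1]%N, [:: 1; 2; 3]%N, 1); ([:: 2; 1]%N, [:: 3; 2; 1]%N, -1);
        ([:: 1; 2]%N, [:: 3; 2; 1]%N, 1)].
- antipode_value antipodeS
    [:: ([:: 1; 1; 1]%N, [:: 2; 3; 1]%N, 1); ([:: 1; 2]%N, [:: 2; 1; 3]%N, 1);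
        ([:: 1; 2]%N, [:: 3; 1; 2]%N, -1)].
- antipode_value antipodeS
    [:: ([:: 2; 1]%N, [:: 2; 3; 1]%N, 1); ([:: 1; 2]%N, [:: 2; 1; 3]%N, 1);
        ([:: 1; 2]%N, [:: 3; 1; 2]%N, -1)].
- antipode_value antipodeS
    [:: ([:: 1; 2]%N, [:: 2; 3; 1]%N, 1); ([:: 2; 1]%N, [:: 2; 1; 3]%N, 1);
        ([:: 2; 1]%N, [:: 3; 1; 2]%N, -1)].
- antipode_value antipodeS
    [:: ([:: 3]%N, [:: 2; 3; 1]%N, 1); ([:: 2; 1]%N, [:: 2; 1; 3]%N, 1);
        ([:: 2; 1]%N, [:: 3; 1; 2]%N, -1)].
- antipode_value antipodeS
    [:: ([:: 1; 1; 1]%N, [:: 3; 1; 2]%N, 1); ([:: 2; 1]%N, [:: 1; 3; 2]%N, 1);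
        ([:: 2; 1]%N, [:: 2; 3; 1]%N, -1)].
- antipode_value antipodeS
    [:: ([:: 2; 1]%N, [:: 3; 1; 2]%N, 1); ([:: 1; 2]%N, [:: 1; 3; 2]%N, 1);
        ([:: 1; 2]%N, [:: 2; 3; 1]%N, -1)].
- antipode_value antipodeS
    [:: ([:: 1; 2]%N, [:: 3; 1; 2]%N, 1); ([:: 2; 1]%N, [:: 1; 3; 2]%N, 1);
        ([:: 2; 1]%N, [:: 2; 3; 1]%N, -1)].
- antipode_value antipodeS
    [:: ([:: 3]%N, [:: 3; 1; 2]%N, 1); ([:: 1; 2]%N, [:: 1; 3; 2]%N, 1);
        ([:: 1; 2]%N, [:: 2; 3; 1]%N, -1)].
- antipode_value antipodeS
    [:: ([:: 1; 2]%N, [:: 2; 1; 3]%N, 1); ([:: 1; 2]%N, [:: 3; 1; 2]%N, -1);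
        ([:: 3]%N, [:: 1; 3; 2]%N, -1); ([:: 3]%N, [:: 2; 3; 1]%N, 1);
        ([:: 1; 1; 1]%N, [:: 2; 3; 1]%N, 1)].
- antipode_value antipodeS
    [:: ([:: 1; 2]%N, [:: 2; 1; 3]%N, 1); ([:: 1; 2]%N, [:: 3; 1; 2]%N, -1);
        ([:: 2; 1]%N, [:: 1; 3; 2]%N, -1); ([:: 2; 1]%N, [:: 2; 3; 1]%N, 2)].
- antipode_value antipodeS
    [:: ([:: 2; 1]%N, [:: 2; 1; 3]%N, 1); ([:: 2; 1]%N, [:: 3; 1; 2]%N, -1);
        ([:: 1; 2]%N, [:: 1; 3; 2]%N, -1); ([:: 1; 2]%N, [:: 2; 3; 1]%N, 2)].
- antipode_value antipodeS
    [:: ([:: 2; 1]%N, [:: 2; 1; 3]%N, 1); ([:: 2; 1]%N, [:: 3; 1; 2]%N, -1);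
        ([:: 1; 1; 1]%N, [:: 1; 3; 2]%N, -1);
        ([:: 1; 1; 1]%N, [:: 2; 3; 1]%N, 1); ([:: 3]%N, [:: 2; 3; 1]%N, 1)].
- antipode_value antipodeS
    [:: ([:: 2; 1]%N, [:: 1; 3; 2]%N, 1); ([:: 2; 1]%N, [:: 2; 3; 1]%N, -1);
        ([:: 3]%N, [:: 2; 1; 3]%N, -1); ([:: 3]%N, [:: 3; 1; 2]%N, 1);
        ([:: 1; 1; 1]%N, [:: 3; 1; 2]%N, 1)].
- antipode_value antipodeS
    [:: ([:: 1; 2]%N, [:: 1; 3; 2]%N, 1); ([:: 1; 2]%N, [:: 2; 3; 1]%N, -1);
        ([:: 2; 1]%N, [:: 2; 1; 3]%N, -1); ([:: 2; 1]%N, [:: 3; 1; 2]%N, 2)].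
- antipode_value antipodeS
    [:: ([:: 2; 1]%N, [:: 1; 3; 2]%N, 1); ([:: 2; 1]%N, [:: 2; 3; 1]%N, -1);
        ([:: 1; 2]%N, [:: 2; 1; 3]%N, -1); ([:: 1; 2]%N, [:: 3; 1; 2]%N, 2)].
- antipode_value antipodeS
    [:: ([:: 1; 2]%N, [:: 1; 3; 2]%N, 1); ([:: 1; 2]%N, [:: 2; 3; 1]%N, -1);
        ([:: 1; 1; 1]%N, [:: 2; 1; 3]%N, -1);
        ([:: 1; 1; 1]%N, [:: 3; 1; 2]%N, 1); ([:: 3]%N, [:: 3; 1; 2]%N, 1)].
Qed.
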